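(* Let $(X,\|\cdot\|)$ be a real normed space, let $X_o = X\setminus\{o\}$, and let $\mathrm{ang_i}:X_o\times X_o\to\mathbb{R}$ be its I-angle, $$\mathrm{ang_i}(x,y)=\arccos\left(\frac{\|x+y\|^2-\|x-y\|^2}{4\|x\|\,\|y\|}\right).$$ Then the following are equivalent: (a) (non-degeneracy) for all $x,y\in X_o$: $\mathrm{ang_i}(x,y)=0$ if and only if $x=\alpha y$ for some $\alpha>0$; (b) (parallelism) for all $x,y\in X_o$: $\mathrm{ang_i}(x,y)=\pi$ if and only if $y=\alpha x$ for some $\alpha<0$; (c) $(X,\|\cdot\|)$ is strictly convex.
   Context: $\arccos:[-1,1]\to[0,\pi]$ is the usual inverse cosine; the argument lies in $[-1,1]$ by the triangle inequality. A normed space is strictly convex if its unit sphere contains no non-degenerate line segment. *)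

(* Defs.v *)
From mathcomp Require Import all_boot all_order all_algebra.
From mathcomp Require Import all_classical all_reals all_analysis.

Set Implicit Arguments.
Unset Strict Implicit.
Unset Printing Implicit Defensive.

Import Order.TTheory GRing.Theory Num.Theory.

Local Open Scope classical_set_scope.
Local Open Scope ring_scope.

(* Total on X, but the angle is only meaningful for nonzero x and y:
   the argument of acos then lies in [-1, 1]. *)
Definition iangle (R : realType) (X : normedModType R) (x y : X) : R :=
  acos ((`|x + y| ^+ 2 - `|x - y| ^+ 2) / (4 * `|x| * `|y|)).

Definition unit_sphere (R : realType) (X : normedModType R) : set X :=
  [set x | `|x| = 1].
Arguments unit_sphere {R} X _.

Definition line_segment (R : realType) (X : normedModType R) (x y : X)
    : set X :=
  [set (1 - t) *: x + t *: y | t in `[0, 1]%classic].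

Definition strictly_convex (R : realType) (X : normedModType R) : Prop :=
  forall x y : X, x != y -> ~ (line_segment x y `<=` unit_sphere X).

(* Main.v *)
(* Since |x+y| <= |x|+|y| and |x-y| >= ||x|-|y||, the I-angle vanishes exactly
   when both are equalities. In a strictly convex space the first equality alone
   puts x and y on a common ray. Conversely, if |x+y| = |x|+|y| then the norm is
   additive on the cone spanned by x and y, so that x+y and x satisfy both
   equalities; nondegeneracy thus puts x+y and x, hence x and y, on a common ray.
   Nondegeneracy and parallelism are exchanged by y |-> -y, which replaces the
   angle by its supplement. *)
Require Import Defs.
From mathcomp Require Import all_boot all_order all_algebra.
From mathcomp Require Import all_classical all_reals all_analysis.
From mathcomp Require Import ring lra.

Import Order.TTheory GRing.Theory Num.Theory.

Local Open Scope classical_set_scope.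
Local Open Scope ring_scope.

(** The upper bound is the triangle inequality. For the lower bound take [t <= s] by symmetry and
    subtract [(s - t) *: y] from [s *: (x + y)], whose norm is known: the reverse triangle
    inequality gives exactly the claimed value. *)
Lemma norm_combination_additive (R : realType) (X : normedModType R) (x y : X)
    (s t : R) :
  0 <= s -> 0 <= t -> `|x + y| = `|x| + `|y| ->
  `|s *: x + t *: y| = s * `|x| + t * `|y|.
Proof.
wlog le_ts : x y s t / t <= s.
  move=> W s0 t0 xy; case/orP: (le_total t s) => [ts|st]; first exact: W.
  by rewrite addrC W ?(addrC y) ?(addrC `|y|)// addrC.
move=> s0 t0 xy; apply/eqP; rewrite eq_le; apply/andP; split.
  by rewrite (le_trans (ler_normD _ _))// !normrZ !ger0_norm.
have -> : s *: x + t *: y = s *: (x + y) - (s - t) *: y.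
  by rewrite scalerDr scalerBl opprB addrA addrAC addrK.
rewrite (le_trans _ (lerB_dist _ _))// !normrZ xy !ger0_norm ?subr_ge0//.
by lra.
Qed.

Lemma strictly_convexP (R : realType) (X : normedModType R) :
  strictly_convex X <->
  forall x y : X, x != 0 -> y != 0 -> `|x + y| = `|x| + `|y| ->
    exists alpha : R, 0 < alpha /\ x = alpha *: y.
Proof.
split=> [sc x y x0 y0 xy|ray u v uv sph].
  have nx : 0 < `|x| by rewrite normr_gt0.
  have ny : 0 < `|y| by rewrite normr_gt0.
  have [e|ne] := eqVneq (`|x|^-1 *: x) (`|y|^-1 *: y).
    exists (`|x| / `|y|); split; first exact: divr_gt0.
    by rewrite -scalerA -e scalerA divff ?scale1r// gt_eqF.
  (* Otherwise the normalised vectors are distinct, and additivity on the cone of [x] and [y] puts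
     the whole segment between them on the unit sphere. *)
  exfalso; apply: (sc _ _ ne) => _ [t /= + <-].
  rewrite in_itv/= => /andP[t0 t1]; rewrite /unit_sphere/= !scalerA.
  rewrite norm_combination_additive// ?divr_ge0 ?subr_ge0//.
  by rewrite !divfK ?gt_eqF// subrK.
have nu : `|u| = 1.
  by apply: sph; exists 0; rewrite /= ?in_itv/= ?lexx ?ler01// subr0 scale1r scale0r addr0.
have nv : `|v| = 1.
  by apply: sph; exists 1; rewrite /= ?in_itv/= ?lexx ?ler01// subrr scale1r scale0r add0r.
(* The midpoint alone suffices: its norm 1 makes the norm additive on [u] and [v], and unit vectors
   on a common ray coincide. *)
have nm : `|2^-1 *: (u + v)| = 1.
  apply: sph; exists 2^-1; first by rewrite /= in_itv/=; lra.
  by rewrite scalerDr; congr (_ *: _ + _); lra.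
have nuv : `|u + v| = `|u| + `|v|.
  by move: nm; rewrite normrZ gtr0_norm ?invr_gt0// nu nv; lra.
have u0 : u != 0 by rewrite -normr_gt0 nu.
have v0 : v != 0 by rewrite -normr_gt0 nv.
have [a [a0 e]] := ray u v u0 v0 nuv.
move: nu uv; rewrite e normrZ nv mulr1 gtr0_norm// => ->.
by rewrite scale1r eqxx.
Qed.

Section IAngle.
Context (R : realType) (X : normedModType R).
Implicit Types x y : X.

Lemma sqr_normD_le x y : `|x + y| ^+ 2 <= (`|x| + `|y|) ^+ 2.
Proof. by rewrite lerXn2r ?nnegrE ?addr_ge0// ler_normD. Qed.

Lemma sqr_normB_ge x y : (`|x| - `|y|) ^+ 2 <= `|x - y| ^+ 2.
Proof.
by rewrite -real_normK ?num_real// lerXn2r ?nnegrE// ler_dist_dist.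
Qed.

(** The bounds on the two squares differ by exactly [4 * |x| * |y|], which gives the upper bound;
    the lower one is the upper one for [x] and [- y]. *)
Lemma iangle_arg_itv x y : x != 0 -> y != 0 ->
  -1 <= (`|x + y| ^+ 2 - `|x - y| ^+ 2) / (4 * `|x| * `|y|) <= 1.
Proof.
rewrite -!normr_gt0 => x0 y0.
have d0 : 0 < 4 * `|x| * `|y| by rewrite !mulr_gt0.
have upper (u v : X) : `|u + v| ^+ 2 - `|u - v| ^+ 2 <= 4 * `|u| * `|v|.
  by have := sqr_normD_le u v; have := sqr_normB_ge u v; nra.
rewrite ler_pdivlMr// ler_pdivrMr// mul1r mulN1r upper andbT.
by have := upper x (- y); rewrite opprK normrN; lra.
Qed.

Lemma iangleN x y : x != 0 -> y != 0 -> iangle x (- y) = pi - iangle x y.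
Proof.
move=> x0 y0; rewrite /iangle -acosN ?iangle_arg_itv//.
by rewrite opprK normrN -(mulNr (_ - _)) opprB.
Qed.

Lemma iangle_eq0 x y : x != 0 -> y != 0 ->
  iangle x y = 0 <->
  `|x + y| = `|x| + `|y| /\ `|x - y| = `| `|x| - `|y| |.
Proof.
move=> x0 y0; have A := iangle_arg_itv x y x0 y0.
move: (x0) (y0); rewrite -!normr_gt0 => nx ny.
have d0 : 4 * `|x| * `|y| != 0 by rewrite !mulf_neq0 ?gt_eqF.
have sq : `| `|x| - `|y| | ^+ 2 = (`|x| - `|y|) ^+ 2.
  by rewrite real_normK ?num_real.
split=> [e|[p q]]; last first.
  rewrite /iangle p q sq -acos1; congr acos.
  by apply: (mulIf d0); rewrite divfK// mul1r; ring.
have : (`|x + y| ^+ 2 - `|x - y| ^+ 2) / (4 * `|x| * `|y|) = 1.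
  by rewrite -[LHS]acosK ?in_itv// -/(iangle x y) e cos0.
move=> /(congr1 ( *%R^~ (4 * `|x| * `|y|))); rewrite divfK// mul1r => E.
(* By [E] the difference of the two squares attains its maximum, so neither bound can be strict. *)
have p := sqr_normD_le x y; have q := sqr_normB_ge x y.
split; apply/eqP; rewrite -(@eqrXn2 _ 2) ?addr_ge0//; apply/eqP.
  by nra.
by rewrite sq; nra.
Qed.

Lemma iangle_ray (a : R) y : 0 < a -> y != 0 -> iangle (a *: y) y = 0.
Proof.
move=> a0 y0; apply/iangle_eq0; rewrite ?scaler_eq0 ?gt_eqF//.
have eD : a *: y + y = (a + 1) *: y by rewrite scalerDl scale1r.
have eB : a *: y - y = (a - 1) *: y by rewrite scalerBl scale1r.
rewrite eD eB !normrZ (gtr0_norm a0) gtr0_norm ?addr_gt0//.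
split; first by ring.
have <- : (a - 1) * `|y| = a * `|y| - `|y| by ring.
by rewrite normrM normr_id.
Qed.

Lemma nondegeneracyP :
  (forall x y, x != 0 -> y != 0 ->
     (iangle x y = 0 <-> exists alpha : R, 0 < alpha /\ x = alpha *: y)) <->
  strictly_convex X.
Proof.
split=> [nd|/strictly_convexP ray x y x0 y0]; last first.
  split=> [/iangle_eq0[]// xy _|[a [a0 ->]]]; first exact: ray.
  exact: iangle_ray.
apply/strictly_convexP => x y x0 y0 xy.
move: (x0) (y0); rewrite -!normr_gt0 => nx ny.
have xy0 : x + y != 0 by rewrite -normr_gt0 xy addr_gt0.
(* The pair [x + y], [x] also satisfies the second equality, as both sides are [|y|]; the original
   pair need not. *)
have [|a [a0 e]] := (nd (x + y) x xy0 x0).1.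
  apply/iangle_eq0 => //; split.
    have -> : x + y + x = 2 *: x + 1 *: y.
      by rewrite scale1r scaler_nat mulr2n addrAC.
    by rewrite norm_combination_additive// xy; ring.
  by rewrite xy ![_ + _ - _]addrAC !subrr !add0r normr_id.
have na : a * `|x| = `|x| + `|y| by rewrite -xy e normrZ gtr0_norm.
(* Here [(a - 1) * |x| = |y| > 0]. *)
have a1 : 0 < a - 1 by rewrite -(pmulr_lgt0 _ nx); lra.
exists (a - 1)^-1; rewrite invr_gt0; split=> //.
have -> : y = (a - 1) *: x by rewrite scalerBl -e scale1r addrC addKr.
by rewrite scalerA mulVf ?scale1r// gt_eqF.
Qed.

Lemma nondegeneracy_parallelism :
  (forall x y, x != 0 -> y != 0 ->
     (iangle x y = 0 <-> exists alpha : R, 0 < alpha /\ x = alpha *: y)) <->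
  (forall x y, x != 0 -> y != 0 ->
     (iangle x y = pi <-> exists alpha : R, alpha < 0 /\ y = alpha *: x)).
Proof.
have angle x y : x != 0 -> y != 0 -> iangle x (- y) = pi <-> iangle x y = 0.
  by move=> x0 y0; rewrite iangleN//; split; lra.
have ray x y : x != 0 -> y != 0 ->
    (exists a : R, a < 0 /\ - y = a *: x) <->
    (exists a : R, 0 < a /\ x = a *: y).
  (* Solving [- y = a *: x] for [x], or [x = a *: y] for [- y], yields the same factor. *)
  move=> x0 y0; split=> -[a [a0 e]]; exists (- a^-1).
    rewrite oppr_gt0 invr_lt0; split=> //.
    by rewrite scaleNr -scalerN e scalerA mulVf ?scale1r// lt_eqF.
  rewrite oppr_lt0 invr_gt0; split=> //.
  by rewrite e scaleNr scalerA mulVf ?scale1r// gt_eqF.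
split=> h x y x0 y0; have Ny0 : - y != 0 by rewrite oppr_eq0.
  have := angle x (- y) x0 Ny0; have := ray x (- y) x0 Ny0.
  rewrite opprK; have := h x (- y) x0 Ny0; tauto.
have := angle x y x0 y0; have := ray x y x0 y0.
have := h x (- y) x0 Ny0; tauto.
Qed.

End IAngle.

Theorem lemma3p2p1 (R : realType) (X : normedModType R) :
  let nondegeneracy :=
    forall x y : X, x != 0 -> y != 0 ->
      (iangle x y = 0 <-> exists alpha : R, 0 < alpha /\ x = alpha *: y) in
  let parallelism :=
    forall x y : X, x != 0 -> y != 0 ->
      (iangle x y = pi <-> exists alpha : R, alpha < 0 /\ y = alpha *: x) in
  (nondegeneracy <-> parallelism) /\
  (parallelism <-> strictly_convex X) /\
  (nondegeneracy <-> strictly_convex X).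
Proof.
have ac := @nondegeneracyP R X; have ab := @nondegeneracy_parallelism R X.
move=> nondegeneracy parallelism; rewrite -/nondegeneracy in ac ab.
rewrite -/parallelism in ab; tauto.
Qed.
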